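(* Let $n$ be a positive integer such that $2n-1$ is a prime power, and let $\lambda=n-1$. There exists a simple and indecomposable $1$-factorization of $\lambda K_{2n}$.
   Context: A prime power is a number $p^m$ with $p$ prime and $m\geq 1$. The complete multigraph $\lambda K_{2n}$ has $2n$ vertices, and each pair of distinct vertices is joined by exactly $\lambda$ edges. A $1$-factor of $\lambda K_{2n}$ is a spanning subgraph consisting of $n$ pairwise independent edges (a perfect matching); two $1$-factors are regarded as equal if they consist of the same unordered pairs of vertices. A $1$-factorization of $\lambda K_{2n}$ is a partition of the edge-(multi)set of $\lambda K_{2n}$ into $1$-factors, i.e. a multiset of $1$-factors such that every pair of distinct vertices is covered exactly $\lambda$ times, counting multiplicities. A $1$-factorization is simple if no $1$-factor is repeated in it. It is decomposable if it is the (multiset) union of a $1$-factorization of $\lambda_0K_{2n}$ and a $1$-factorization of $(\lambda-\lambda_0)K_{2n}$ for some integer $\lambda_0$ with $1\le\lambda_0<\lambda$; otherwise it is indecomposable. *)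

(* Defs.v *)
From mathcomp Require Import all_boot finmap multiset.

Set Implicit Arguments.
Unset Strict Implicit.
Unset Printing Implicit Defensive.

Local Open Scope mset_scope.
Local Open Scope nat_scope.

Definition prime_power (q : nat) : Prop :=
  exists p m : nat, [/\ prime p, 1 <= m & q = p ^ m].

(* An edge of the complete (multi)graph on T is a two-element subset of T. The
   parallel edges joining two vertices are not distinguished, so that a
   1-factor is a set of such pairs. *)
Definition one_factor (T : finType) (F : {set {set T}}) : Prop :=
  (forall e : {set T}, e \in F -> #|e| = 2) /\ partition F [set: T].

(* For a multiset M, M F is the multiplicity of F in M and F \in M means that
   this multiplicity is nonzero. *)
Definition one_factorization (T : finType) (lambda : nat)
    (M : {mset {set {set T}}}) : Prop :=
  (forall F : {set {set T}}, F \in M -> one_factor F) /\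
  (forall x y : T, x != y ->
     \sum_(F : {set {set T}} | [set x; y] \in F) M F = lambda).

Definition simple_factorization (T : finType)
    (M : {mset {set {set T}}}) : Prop :=
  forall F : {set {set T}}, M F <= 1.

(* `+` adds multiplicities. *)
Definition decomposable (T : finType) (lambda : nat)
    (M : {mset {set {set T}}}) : Prop :=
  exists lambda0 : nat, 1 <= lambda0 < lambda /\
    exists M1 M2 : {mset {set {set T}}},
      [/\ one_factorization lambda0 M1,
          one_factorization (lambda - lambda0) M2
        & M = M1 `+` M2].

(* Main.v *)
Require Import Defs.
From mathcomp Require Import all_boot all_algebra all_field finmap multiset.
From mathcomp Require Import zify ring.

(** Put q = 2n - 1 and let F be the field with q elements; the vertices are the
    points of F together with one point at infinity (the value None of
    option F). Since q is odd, F has odd characteristic.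

    Take a 1-factor consisting of the edge {oo, 0} and of the edges
    {x, sigma x}, x <> 0, for an involution sigma of F that fixes only 0 and
    commutes with negation, and let the maps x |-> a x + b (a <> 0) act on it.
    Each edge lies in the images under exactly q - 1 of these maps: at infinity
    b is determined and a is free, and a finite edge is an image of each of the
    (q - 1) / 2 finite edges under two maps, as the group is sharply
    2-transitive on F. The scales a and - a give the same image. If no other
    coincidences occur, each edge lies in (q - 1) / 2 = n - 1 members of the
    orbit, and the orbit, each member taken once, is the required
    1-factorization.

    The absence of other coincidences and the indecomposability both come from
    one property of sigma: more than half of the nonzero x satisfy
    sigma x - x = 1 or -1 (lemma [unit_step_involution]). Call a the scale of
    the image under x |-> a x + b. More than half of the finite edges of an
    image of scale a then have difference a or -a, so that the
    image determines its scale up to sign ([affine_factor_eq]).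

    Suppose that a part of the orbit covers each edge l0 times, where
    0 < l0 < n - 1. Let N a be the number of b for which the image under
    x |-> a x + b lies in that part; then N (- a) = N a. Counting the edges of difference d gives
      sum over u <> 0 of N (d / (sigma u - u)) = 2 l0 q   for every d <> 0,
    where more than half of the terms on the left are equal to N d. Comparing
    the equations at a maximum and at a minimum of N shows that N is constant
    ([majority_const]). Hence (q - 1) N 1 = 2 l0 q, and as n - 1 = (q - 1) / 2
    is prime to q, it divides l0, which is absurd
    ([orbit_indecomposable]). *)

Set Implicit Arguments.
Unset Strict Implicit.
Unset Printing Implicit Defensive.

Import GRing.Theory.
Local Open Scope mset_scope.
Local Open Scope ring_scope.

(** * An involution with mostly unit steps *)

Lemma odd_pchar_two_neq0 (F : fieldType) (p : nat) :
  p \in [pchar F] -> odd p -> 2 != 0 :> F.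
Proof.
move=> chp p_odd; rewrite -(dvdn_pcharf chp); apply: contraTN p_odd => d2.
move: (dvdn_leq (isT : (0 < 2)%N) d2) (prime_gt1 (pcharf_prime chp)) => le2 gt1.
by have -> : p = 2 by lia.
Qed.

(** Adding 1 to x adds 1 to the coordinate phi x, so each additive coset of the
    prime field is mapped onto 'F_p compatibly with the step x |-> x + 1. *)
Lemma unital_functional (F : finFieldType) (p : nat) (chp : p \in [pchar F]) :
  exists phi : F -> 'F_p, {morph phi : x y / x + y} /\ phi 1 = 1.
Proof.
pose V := pPrimeCharType chp; pose v : V := 1.
have fr : free [:: v] by rewrite free_cons nil_free span_nil memv0 oner_eq0.
exists (fun x : F => coord [tuple v] ord0 (projv <[v]> (x : V))); split.
  by move=> x y; rewrite -!linearD.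
by rewrite projv_id ?memv_line // (coord_free ord0 ord0 fr).
Qed.

Section Parity.

Variables (p : nat) (p_pr : prime p) (p_odd : odd p).
Implicit Type c : 'F_p.

Lemma Fp_cast_mod k : (k %% (Zp_trunc (pdiv p)).+2 = k %% p)%N.
Proof. by rewrite Fp_cast. Qed.

Lemma val_Fp_add1 c : c != -1 -> (c + 1)%R = c.+1 :> nat.
Proof.
move=> c1; have p2 := prime_gt1 p_pr.
have vc1 : (c + 1)%R = ((c + 1) %% p)%N :> nat by rewrite /= modnDmr Fp_cast_mod.
have cp : (c < p)%N by rewrite -[X in (_ < X)%N](Fp_cast p_pr).
rewrite vc1; have [cp1|] := ltnP (c + 1)%N p; first by rewrite modn_small // addn1.
move=> cp1; have pE : p = (c + 1)%N by lia.
case/eqP: c1; apply/eqP; rewrite -addr_eq0; apply/eqP/ord_inj.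
by rewrite vc1 -pE modnn.
Qed.

Lemma val_Fp_opp c : c != 0 -> (- c)%R = (p - c)%N :> nat.
Proof.
move=> c0; have cp : (c < p)%N by rewrite -[X in (_ < X)%N](Fp_cast p_pr).
have c1 : (0 < c)%N by rewrite lt0n; apply: contra c0 => /eqP c0; apply/eqP/val_inj.
have -> : (- c)%R = ((p - c) %% p)%N :> nat.
  by rewrite /= Fp_cast_mod; congr ((_ - _) %% _)%N; apply: Fp_cast.
by rewrite modn_small //; lia.
Qed.

(** Residues are represented in 0, ..., p - 1, and p is odd; so negation
    exchanges the odd and the even nonzero representatives. *)
Lemma odd_Fp_opp c : c != 0 -> odd (- c)%R = ~~ odd c.
Proof.
move=> c0; have cp : (c < p)%N by rewrite -[X in (_ < X)%N](Fp_cast p_pr).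
by rewrite val_Fp_opp // oddB ?p_odd 1?ltnW.
Qed.

(** An odd representative is not p - 1, so adding 1 does not wrap around. *)
Lemma odd_Fp_add1 c : odd c -> ~~ odd (c + 1)%R /\ c + 1 != 0.
Proof.
move=> oc; have c0 : c != 0 by apply: contraTneq oc => ->.
have c1 : c != -1.
  by apply: contraTneq oc => ->; rewrite odd_Fp_opp ?oner_eq0.
have v := val_Fp_add1 c1; rewrite v /= oc; split=> //.
by apply/eqP=> e; move: v; rewrite e.
Qed.

Lemma even_Fp_sub1 c : c != 0 -> ~~ odd c -> odd (c - 1)%R.
Proof.
move=> c0 oc.
have onc : odd (- c)%R by rewrite odd_Fp_opp.
have [o n0] := odd_Fp_add1 onc.
have -> : c - 1 = - (- c + 1) by rewrite opprD opprK.
by rewrite odd_Fp_opp.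
Qed.

End Parity.

(** In each additive coset of the prime field the nonzero coordinates are paired
    as {1, 2}, {3, 4}, ..., {p - 2, p - 1}, and the points of coordinate 0 form
    a subspace, on which negation is used. At most half of the points have
    coordinate 0, because that subspace is disjoint from its translate by 1. *)
Lemma unit_step_involution (F : finFieldType) (p : nat) :
  p \in [pchar F] -> odd p ->
  exists sigma : F -> F,
    [/\ involutive sigma,
        {morph sigma : x / - x},
        forall x, (sigma x == x) = (x == 0)
      & (#|F| <= 2 * #|[set x | (sigma x - x == 1)%R || (sigma x - x == -1)%R]|)%N].
Proof.
move=> chp p_odd; have p_pr := pcharf_prime chp.
have [phi [phiD phi1]] := unital_functional chp.
have phi0 : phi 0 = 0 by apply: (addrI (phi 0)); rewrite -phiD !addr0.
have phiN x : phi (- x) = - phi x.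
  by apply: (addrI (phi x)); rewrite -phiD !subrr phi0.
have two0 := odd_pchar_two_neq0 chp p_odd.
pose sigma x := if phi x == 0 then - x else if odd (phi x) then x + 1 else x - 1.
have so x : odd (phi x) -> sigma x = x + 1.
  by rewrite /sigma => ox; rewrite ox; case: eqP ox => // ->.
have se x : phi x != 0 -> ~~ odd (phi x) -> sigma x = x - 1.
  by rewrite /sigma => /negPf-> /negPf->.
have s0 x : phi x = 0 -> sigma x = - x by rewrite /sigma => ->; rewrite eqxx.
have n0 x : odd (phi x) -> phi x != 0 by apply: contraTneq => ->.
have cases x : [\/ phi x = 0, odd (phi x) | phi x != 0 /\ ~~ odd (phi x)].
  have [|x0] := eqVneq (phi x) 0; first by constructor 1.
  by have [|] := boolP (odd (phi x)); [constructor 2 | constructor 3].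
exists sigma; split.
- move=> x; have [x0|ox|[x0 ex]] := cases x.
  + by rewrite (s0 x) // s0 ?opprK // phiN x0 oppr0.
  + have [e1 e2] := odd_Fp_add1 p_pr p_odd ox.
    by rewrite (so x) // se ?phiD ?phi1 // addrK.
  + rewrite (se x) // so ?subrK // phiD phiN phi1.
    exact: even_Fp_sub1.
- move=> x; have [x0|ox|[x0 ex]] := cases x.
  + by rewrite !s0 // phiN x0 oppr0.
  + rewrite (so x) // se ?opprD // phiN ?oppr_eq0 ?n0 //.
    by rewrite odd_Fp_opp ?negbK // n0.
  + by rewrite (se x) // so ?opprB ?[- x + 1]addrC // phiN odd_Fp_opp.
- move=> x; have [x0|ox|[x0 ex]] := cases x.
  + rewrite s0 // eq_sym -subr_eq0 opprK -mulr2n -mulr_natl mulf_eq0.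
    by rewrite (negPf two0).
  + rewrite so // -subr_eq0 addrAC subrr add0r oner_eq0.
    by apply/esym; apply: contraTF ox => /eqP->; rewrite phi0.
  + rewrite se // -subr_eq0 addrAC subrr add0r oppr_eq0 oner_eq0.
    by apply/esym; apply: contraNF x0 => /eqP->; rewrite phi0.
(* The points outside the subspace K have unit steps. *)
pose K := [set x | phi x == 0].
have disj : #|K| = #|[set x + 1 | x in K]| by rewrite card_imset //; apply: addIr.
set S := [set x | _].
have subK : ~: K \subset S.
  apply/subsetP=> x; rewrite !inE => x0.
  case: (cases x) => [e|ox|[_ ex]]; first by rewrite e eqxx in x0.
  - by rewrite so // addrAC subrr add0r eqxx.
  - by rewrite se // addrAC subrr add0r eqxx orbT.
have subK1 : [set x + 1 | x in K] \subset ~: K.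
  apply/subsetP=> _ /imsetP[x + ->]; rewrite !inE => /eqP x0.
  by rewrite phiD x0 add0r phi1 oner_eq0.
have leKC : (#|K| <= #|~: K|)%N by rewrite disj subset_leq_card.
have leKS := subset_leq_card subK.
by rewrite -(cardsC K) mul2n -addnn leq_add // (leq_trans leKC).
Qed.

(** * The 1-factor of a fixed-point-free involution *)

Section InvolutionFactor.

Variable T : finType.
Implicit Types (tau : T -> T) (x y : T).

Definition factor_of tau : {set {set T}} := [set [set x; tau x] | x : T].

Lemma mem_factor_of tau x y : involutive tau -> x != y ->
  ([set x; y] \in factor_of tau) = (tau x == y).
Proof.
move=> tauK xy; apply/imsetP/eqP=> [[t _ e]|<-]; last by exists x.
have : x \in [set t; tau t] by rewrite -e set21.
have : y \in [set t; tau t] by rewrite -e set22.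
rewrite !inE => /orP[]/eqP ey /orP[]/eqP ex; rewrite ex ey ?tauK //.
  by rewrite ex ey eqxx in xy.
by rewrite ex ey eqxx in xy.
Qed.

Lemma factor_of_inj tau tau' :
  involutive tau -> (forall x, tau x != x) -> involutive tau' ->
  factor_of tau = factor_of tau' -> tau =1 tau'.
Proof.
move=> tauK tauN tauK' e x; apply/esym/eqP.
rewrite -mem_factor_of //; last by rewrite eq_sym.
by rewrite -e; apply: imset_f.
Qed.

Lemma factor_ofP tau :
  involutive tau -> (forall x, tau x != x) -> one_factor (factor_of tau).
Proof.
move=> tauK tauN; split=> [e /imsetP[x _ ->]|]; first by rewrite cards2 eq_sym tauN.
apply/and3P; split.
- rewrite eqEsubset subsetT /=; apply/subsetP=> x _.
  apply/bigcupP; exists [set x; tau x]; first exact: imset_f.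
  exact: set21.
- apply/trivIsetP=> _ _ /imsetP[x _ ->] /imsetP[y _ ->] neq.
  rewrite -setI_eq0; apply/eqP/setP=> z; rewrite !inE.
  apply: contraNF neq => /andP[zx zy].
  have pair t : (z == t) || (z == tau t) -> [set t; tau t] = [set z; tau z].
    by case/orP=> /eqP->; rewrite ?tauK // setUC.
  by rewrite (pair x zx) (pair y zy).
- by apply/imsetP=> -[x _ /setP/(_ x)]; rewrite !inE eqxx.
Qed.

End InvolutionFactor.

Lemma mulf_divK (F : fieldType) (a z : F) : a != 0 -> a * z / a = z.
Proof. by move=> a0; rewrite mulrC mulKf. Qed.

Lemma mulf_divCK (F : fieldType) (a z : F) : a != 0 -> a * (z / a) = z.
Proof. by move=> a0; rewrite mulrC divfK. Qed.

(** * The affine orbit and its edge counts *)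

Section AffineOrbit.

Variables (F : finFieldType) (T : finType) (g : option F -> T) (h : T -> option F).
Implicit Types (a b c d u : F) (p : F * F).
Hypotheses (gK : cancel g h) (hK : cancel h g).
Hypothesis two_neq0 : 2 != 0 :> F.
Variable sigma : F -> F.
Hypotheses (sigmaK : involutive sigma) (sigmaN : {morph sigma : x / - x}).
Hypothesis sigma_fix : forall x, (sigma x == x) = (x == 0).
Let step (x : F) := sigma x - x.
Definition unit_steps := [set u | (step u == 1) || (step u == -1)].
Hypothesis many_unit : (#|F| <= 2 * #|unit_steps|)%N.

Let sigma0 : sigma 0 = 0.
Proof. by apply/eqP; rewrite sigma_fix. Qed.

Let step_eq0 x : (step x == 0) = (x == 0).
Proof. by rewrite subr_eq0 sigma_fix. Qed.

Lemma unit_step_neq0 u : u \in unit_steps -> u != 0.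
Proof.
apply: contraTneq => ->; rewrite inE /step sigma0 subrr.
by rewrite eq_sym oner_eq0 eq_sym oppr_eq0 oner_eq0.
Qed.

(** The neighbour of a vertex in the image of {oo, 0}, {x, sigma x} (x <> 0)
    under x |-> p.1 x + p.2. *)
Definition affine_partner (p : F * F) (x : option F) : option F :=
  match x with
  | None => Some p.2
  | Some x => if x == p.2 then None else Some (p.1 * sigma ((x - p.2) / p.1) + p.2)
  end.

Lemma affine_partnerK p : p.1 != 0 -> involutive (affine_partner p).
Proof.
case: p => a b /= a0 [x|] /=; last by rewrite eqxx.
have [->|xb] //= := eqVneq x b.
rewrite addrK mulf_divK // sigmaK -subr_eq0 addrK mulf_eq0 (negPf a0) /=.
rewrite mulf_divCK // subrK.
have u0 : (x - b) / a != 0 by rewrite mulf_neq0 ?invr_eq0 ?subr_eq0.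
rewrite ifN //; apply: contra u0 => /eqP s0.
by rewrite -[_ / _]sigmaK s0 sigma0.
Qed.

Lemma affine_partner_fixfree p x : p.1 != 0 -> affine_partner p x != x.
Proof.
case: p x => a b [x|] //= a0.
have [//|xb] := eqVneq x b.
apply/eqP=> -[e].
have : sigma ((x - b) / a) == (x - b) / a.
  by rewrite -(inj_eq (mulfI a0)) -(inj_eq (addIr b)) e mulf_divCK ?subrK.
by rewrite sigma_fix mulf_eq0 invr_eq0 (negPf a0) subr_eq0 (negPf xb).
Qed.

Definition affine_factor p := factor_of (g \o affine_partner p \o h).

Let tauK p : p.1 != 0 -> involutive (g \o affine_partner p \o h).
Proof. by move=> p0 t; rewrite /= gK affine_partnerK ?hK. Qed.

Let tau_fixfree p : p.1 != 0 -> forall t, (g \o affine_partner p \o h) t != t.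
Proof.
by move=> p0 t; rewrite /= -{2}(hK t) (inj_eq (can_inj gK)) affine_partner_fixfree.
Qed.

Lemma affine_factorP p : p.1 != 0 -> one_factor (affine_factor p).
Proof. by move=> p0; apply: factor_ofP; [apply: tauK | apply: tau_fixfree]. Qed.

Lemma mem_affine_factor p x y : p.1 != 0 -> x != y ->
  ([set g x; g y] \in affine_factor p) = (affine_partner p x == y).
Proof.
move=> p0 xy; rewrite mem_factor_of /= ?gK ?(inj_eq (can_inj gK)) //.
exact: tauK.
Qed.

Lemma affine_factor_opp a b : affine_factor (- a, b) = affine_factor (a, b).
Proof.
apply: eq_imset => t /=; congr [set _; g _].
case: (h t) => //= x; case: eqP => // _.
by rewrite invrN mulrN sigmaN mulrNN.
Qed.

(** Two images that coincide have the same neighbour of infinity, hence the same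
    translation part. Each of them has steps plus or minus its scale at more
    than half of the points, so at some point both have such steps. *)
Lemma affine_factor_eq a b a' b' : a != 0 -> a' != 0 ->
  (affine_factor (a', b') == affine_factor (a, b)) =
  ((a', b') \in [set (a, b); (- a, b)]).
Proof.
move=> a0 a0'; rewrite !inE; apply/eqP/orP=> [e|[]/eqP[-> ->] //];
  last exact: affine_factor_opp.
have {}e x : affine_partner (a', b') x = affine_partner (a, b) x.
  have := factor_of_inj (tauK _) (tau_fixfree _) (tauK _) e (g x).
  by rewrite /= gK => /(_ a0' a0' a0) /(can_inj gK).
have [eb] := e None; rewrite {}eb in e *.
have {}e x : x != 0 -> a' * step (x / a') = a * step (x / a).
  move=> x0; have := e (Some (x + b)).
  rewrite /= -subr_eq0 addrK (negPf x0) => -[/addIr].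
  by rewrite /step !mulrBr !mulf_divCK // => ->.
(* The points where the image of scale c, with b = 0, has step c or - c. *)
pose S (c : F) := [set c * u | u in unit_steps].
have cardS c : c != 0 -> #|S c| = #|unit_steps|.
  by move=> c0; rewrite card_imset //; apply: mulfI.
have S0 c : c != 0 -> 0 \notin S c.
  move=> c0; apply/imsetP=> -[u /unit_step_neq0 u0 /esym/eqP].
  by rewrite mulf_eq0 (negPf c0) (negPf u0).
have [x Sx Sx'] : exists2 x, x \in S a & x \in S a'.
  apply/exists_inP; apply: contraT; rewrite negb_exists_in => /forall_inP disj.
  have sub : S a \subset ~: (0 |: S a').
    apply/subsetP=> x Sx; rewrite !inE negb_or disj // andbT.
    by apply: contraNneq (S0 a a0) => <-.
  have := subset_leq_card sub; have := many_unit.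
  have -> : #|F| = (#|0%R |: S a'| + #|~: (0%R |: S a')|)%N := esym (cardsC _).
  rewrite cardsU1 S0 // !cardS //; move: #|unit_steps| #|~: _| => m k /=; lia.
have stepS c : c != 0 -> x \in S c -> c * step (x / c) = c \/ c * step (x / c) = - c.
  move=> c0 /imsetP[u + ->]; rewrite mulf_divK // inE.
  by case/orP=> /eqP->; rewrite ?mulr1 ?mulrN1; [left | right].
have x0 : x != 0 by apply: contraNneq (S0 a a0) => <-.
have := e x x0.
by case: (stepS a a0 Sx) => ->; case: (stepS a' a0' Sx') => ->;
  [move=> -> | move/eqP; rewrite eqr_oppLR => /eqP-> | move=> -> | move/oppr_inj->];
  rewrite eqxx; [left | right | right | left].
Qed.

Definition orbit : {set {set {set T}}} :=
  [set affine_factor p | p : F * F & p.1 != 0].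

(** Summing over all (a, b) instead of over the orbit counts everything twice,
    as (a, b) and (- a, b) give the same 1-factor. This avoids choosing
    representatives of the scales up to sign. *)
Lemma sum_orbit (w : {set {set T}} -> nat) (e : {set T}) :
  (forall H, H \notin orbit -> w H = 0%N) ->
  (2 * \sum_(H : {set {set T}} | e \in H) w H =
   \sum_(p : F * F | (p.1 != 0%R) && (e \in affine_factor p)) w (affine_factor p))%N.
Proof.
move=> w0.
transitivity (\sum_(p in [set p : F * F | p.1 != 0%R])
    if e \in affine_factor p then w (affine_factor p) else 0)%N;
  last by rewrite -big_mkcondr; apply: eq_bigl => p; rewrite inE.
rewrite (partition_big_imset affine_factor) /=.
rewrite [in LHS](bigID (mem orbit)) /= [X in (_ + X)%N]big1 ?addn0; last first.
  by move=> H /andP[_ /w0].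
rewrite big_distrr /= [in LHS]big_mkcondl /=.
rewrite -/orbit.
apply: eq_bigr => _ /imsetP[[a b] + ->]; rewrite inE /= => a0.
rewrite (eq_bigl [in [set (a, b); (- a, b)]]); last first.
  move=> [a' b'] /=; rewrite inE /=.
  have [->|a0'] := eqVneq a' 0; last by rewrite affine_factor_eq.
  by rewrite !inE !xpair_eqE ![0 == _]eq_sym oppr_eq0 (negPf a0).
rewrite big_setU1 ?big_set1 /= ?affine_factor_opp.
  by case: ifP => _ //; rewrite mul2n addnn.
rewrite inE xpair_eqE eqxx andbT -subr_eq0 opprK -mulr2n -mulr_natl mulf_eq0.
by rewrite (negPf two_neq0).
Qed.

Lemma sum_edge_infty (w : {set {set T}} -> nat) (b : F) :
  (forall H, H \notin orbit -> w H = 0%N) ->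
  (2 * \sum_(H : {set {set T}} | [set g None; g (Some b)] \in H) w H =
   \sum_(a : F | a != 0%R) w (affine_factor (a, b)))%N.
Proof.
move=> w0; rewrite sum_orbit //.
rewrite (reindex_onto (fun a => (a, b)) fst) /=; last first.
  by move=> [a b'] /= /andP[a0]; rewrite mem_affine_factor //= => /eqP[->].
apply: eq_bigl => a; rewrite eqxx andbT.
by have [//|a0] := eqVneq a 0; rewrite mem_affine_factor //= eqxx.
Qed.

(** The affine maps that send some {u, sigma u} onto {x, x + d} with u going to x
    are parametrized by u: the scale has to be d / step u. *)
Lemma sum_edge_finite (w : {set {set T}} -> nat) (x d : F) : d != 0 ->
  (forall H, H \notin orbit -> w H = 0%N) ->
  (2 * \sum_(H : {set {set T}} | [set g (Some x); g (Some (x + d)%R)] \in H) w H =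
   \sum_(u : F | u != 0%R) w (affine_factor (d / step u, x - d / step u * u)%R))%N.
Proof.
move=> d0 w0; rewrite sum_orbit //.
have xd : Some x != Some (x + d).
  by rewrite (inj_eq (@Some_inj _)) -subr_eq0 opprD addrA subrr add0r oppr_eq0.
rewrite (reindex_onto (fun u => (d / step u, x - d / step u * u))
                      (fun p => (x - p.2) / p.1)) /=; last first.
  move=> [a b] /= /andP[a0]; rewrite mem_affine_factor //=.
  have [//|xb] := eqVneq x b; move=> /eqP[e].
  set u := (x - b) / a in e *.
  have au : a * u = x - b by rewrite mulf_divCK.
  have u0 : u != 0 by rewrite mulf_neq0 ?invr_eq0 ?subr_eq0.
  have aD : a * step u = d by rewrite /step mulrBr au -[RHS](addKr x) -e; ring.
  have aE : d / step u = a by rewrite -aD mulfK // step_eq0.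
  by rewrite aE au opprB addrCA subrr addr0.
apply: eq_bigl => u.
have [->|u0] := eqVneq u 0.
  by rewrite /step sigma0 subrr invr0 mulr0 eqxx.
have a0 : d / step u != 0 by rewrite mulf_neq0 ?invr_eq0 ?step_eq0.
rewrite a0 /= mem_affine_factor //=.
have au0 : d / step u * u != 0 by rewrite mulf_neq0.
rewrite -{1}subr_eq0 opprB addrCA subrr addr0 (negPf au0).
rewrite mulf_divK // eqxx andbT.
apply/eqP; congr Some.
by rewrite addrCA -mulrBr -/(step u) divfK // step_eq0.
Qed.

Lemma card_neq0 : #|[pred x : F | x != 0]| = #|F|.-1.
Proof. by rewrite (cardC1 (0 : F)). Qed.

(** * Simplicity and indecomposability *)

Definition orbit_mset : {mset {set {set T}}} := seq_mset (enum orbit).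

Lemma orbit_msetE H : orbit_mset H = (H \in orbit).
Proof. by rewrite mset_seqE count_uniq_mem ?enum_uniq // mem_enum. Qed.

Lemma affine_factor_in_orbit p : p.1 != 0 -> affine_factor p \in orbit.
Proof. by move=> p0; apply/imsetP; exists p; rewrite ?inE. Qed.

Lemma orbit_simple : simple_factorization orbit_mset.
Proof. by move=> H; rewrite orbit_msetE leq_b1. Qed.

Lemma orbit_factorization lambda : #|F| = (2 * lambda).+1 ->
  one_factorization lambda orbit_mset.
Proof.
move=> cardF.
have w0 H : H \notin orbit -> orbit_mset H = 0%N.
  by rewrite orbit_msetE => /negPf->.
have constsum (f : F -> F * F) : (forall a, a != 0 -> (f a).1 != 0) ->
  \sum_(a : F | a != 0) orbit_mset (affine_factor (f a)) = (2 * lambda)%N.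
  move=> f0; rewrite (eq_bigr (fun=> 1%N)); last first.
    by move=> a a0; rewrite orbit_msetE affine_factor_in_orbit ?f0.
  by rewrite sum1_card card_neq0 cardF.
split=> [H|].
  rewrite -mset_gt0 orbit_msetE lt0b => /imsetP[p + ->].
  by rewrite inE; apply: affine_factorP.
have half m : (2 * m = 2 * lambda -> m = lambda)%N by lia.
have infty b : \sum_(H : {set {set T}} | [set g None; g (Some b)] \in H)
    orbit_mset H = lambda.
  by apply: half; rewrite sum_edge_infty // constsum.
move=> s t; rewrite -(hK s) -(hK t).
case: (h s) (h t) => [x|] [y|] neq; last by rewrite eqxx in neq.
- have d0 : y - x != 0.
    by rewrite subr_eq0; apply: contra neq => /eqP->.
  apply: half; have {1}-> : y = x + (y - x) by rewrite addrC subrK.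
  rewrite sum_edge_finite // constsum // => u u0 /=.
  by rewrite mulf_neq0 ?invr_eq0 ?step_eq0.
- by rewrite setUC infty.
- exact: infty.
Qed.

(** A weighted average principle: N d makes up more than half of the sum
    attached to d. If N dM is the maximum and N dm the minimum, equality of the
    sums attached to dM and dm forces N dM <= N dm. *)
Lemma majority_const (N : F -> nat) (k : nat) :
  (forall d, N (- d) = N d) ->
  (forall d, d != 0 -> (\sum_(u : F | u != 0%R) N (d / step u)%R)%N = k) ->
  forall d d', d != 0 -> d' != 0 -> (N d <= N d')%N.
Proof.
move=> Nopp Nsum.
have [dM dM0 maxM] : exists2 dM, dM != 0 & forall d, d != 0 -> (N d <= N dM)%N.
  by case: (@arg_maxnP F 1 (fun d => d != 0) N (oner_neq0 F)) => dM; exists dM.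
have [dm dm0 minm] : exists2 dm, dm != 0 & forall d, d != 0 -> (N dm <= N d)%N.
  by case: (@arg_minnP F 1 (fun d => d != 0) N (oner_neq0 F)) => dm; exists dm.
suff le : (N dM <= N dm)%N.
  by move=> d d' d0 d0'; rewrite (leq_trans (maxM d d0)) // (leq_trans le) ?minm.
pose c := #|[pred u | (u != 0) && (u \notin unit_steps)]|.
have cE : (#|unit_steps| + c = #|F|.-1)%N.
  rewrite -card_neq0 -(cardID (mem unit_steps) [pred x : F | x != 0]).
  congr (_ + _)%N.
    by apply: eq_card => u; apply/idP/andP=> [uS|[]//]; split=> //; apply: unit_step_neq0.
  by apply: eq_card => u; rewrite !inE andbC.
have split_sum d : (\sum_(u : F | u != 0%R) N (d / step u)%R =
    #|unit_steps| * N d +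
    \sum_(u | (u != 0%R) && (u \notin unit_steps)) N (d / step u)%R)%N.
  rewrite (bigID (mem unit_steps)) /=; congr (_ + _)%N.
  rewrite -sum_nat_const; apply: eq_big => [u|u /andP[_]].
    by apply: andb_idl; apply: unit_step_neq0.
  by rewrite inE => /orP[]/eqP->; rewrite ?divr1 ?invrN1 ?mulrN1.
have lo : (c * N dm <=
    \sum_(u | (u != 0%R) && (u \notin unit_steps)) N (dM / step u)%R)%N.
  rewrite -sum_nat_const; apply: leq_sum => u /andP[u0 _].
  by apply: minm; rewrite mulf_neq0 ?invr_eq0 ?step_eq0.
have hi : (\sum_(u | (u != 0%R) && (u \notin unit_steps)) N (dm / step u)%R
    <= c * N dM)%N.
  rewrite -sum_nat_const; apply: leq_sum => u /andP[u0 _].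
  by apply: maxM; rewrite mulf_neq0 ?invr_eq0 ?step_eq0.
move: (Nsum dM dM0) (Nsum dm dm0) (minm dM dM0); rewrite !split_sum.
have Fpos : (0 < #|F|)%N by apply/card_gt0P; exists 0.
move: many_unit cE Fpos lo hi.
move: (N dM) (N dm) #|unit_steps| #|F| c (\sum_(u | _) _)%N (\sum_(u | _) _)%N.
nia.
Qed.

Lemma orbit_indecomposable lambda : #|F| = (2 * lambda).+1 ->
  ~ decomposable lambda orbit_mset.
Proof.
move=> cardF [l0 [/andP[l0_gt0 l0_lt] [M1 [M2 [[_ fac1] _ defM]]]]].
have w0 H : H \notin orbit -> M1 H = 0%N.
  move=> /negPf Hn; have := orbit_msetE H; rewrite Hn defM msetE2.
  by case: (M1 H).
(* N is even because a ranges over signed scales; so the steps 1 and - 1 both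
   contribute N d to the sum attached to d. *)
pose N a := (\sum_(b : F) M1 (affine_factor (a, b)))%N.
have Nopp a : N (- a) = N a by apply: eq_bigr => b _; rewrite affine_factor_opp.
have Nsum d : d != 0 ->
    (\sum_(u : F | u != 0%R) N (d / step u)%R = #|F| * (2 * l0))%N.
  (* Add up the covering conditions of the edges {x, x + d} over all x. *)
  move=> d0; rewrite -sum_nat_const.
  rewrite [RHS](eq_bigr (fun x : F =>
    (\sum_(u : F | u != 0%R) M1 (affine_factor (d / step u, x - d / step u * u)%R))%N));
    last first.
    move=> x _; rewrite -sum_edge_finite // fac1 //.
    rewrite (can_eq gK) (inj_eq (@Some_inj _)) -subr_eq0 opprD addrA subrr add0r.
    by rewrite oppr_eq0.
  rewrite [RHS]exchange_big /=; apply: eq_bigr => u _.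
  by rewrite /N (reindex_inj (addIr (- (d / step u * u)))).
have Nconst a : a != 0 -> N a = N 1.
  by move=> a0; apply/eqP; rewrite eqn_leq !(majority_const Nopp Nsum) ?oner_eq0.
have := Nsum 1 (oner_neq0 F).
rewrite (eq_bigr (fun=> N 1)); last first.
  by move=> u u0; rewrite Nconst // mul1r invr_eq0 step_eq0.
rewrite sum_nat_const card_neq0 cardF /=.
move=> eqN.
have dvd : (lambda %| (2 * lambda).+1 * l0)%N.
  by apply/dvdnP; exists (N 1); move: eqN; lia.
move: dvd; rewrite Gauss_dvdr; last by rewrite /coprime -addn1 gcdnMDl gcdn1.
by move/(dvdn_leq l0_gt0); lia.
Qed.

End AffineOrbit.

(** * The theorem *)

Unset Implicit Arguments.
Local Open Scope nat_scope.

Theorem theorem3 (n lambda : nat) (hn : 0 < n)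
    (hq : prime_power (2 * n - 1)) (hlambda : lambda = n - 1) :
  exists M : {mset {set {set 'I_(2 * n)}}},
    [/\ one_factorization lambda M,
        simple_factorization M
      & ~ decomposable lambda M].
Proof.
have [p [m [p_pr m_gt0 qE]]] := hq.
have p_odd : odd p.
  have : odd (p ^ m) by rewrite -qE oddB ?oddM //; lia.
  by rewrite oddX; case: m m_gt0 {qE}.
have [F chF cardF] := pPrimePowerField p_pr m_gt0.
have two_neq0 := odd_pchar_two_neq0 chF p_odd.
have [sigma [sigmaK sigmaN sigma_fix many_unit]] := unit_step_involution chF p_odd.
have cardF' : #|F| = (2 * lambda).+1 by rewrite cardF -qE; lia.
have cardV : #|{: option F}| = 2 * n by rewrite card_option cardF'; lia.
pose g (x : option F) : 'I_(2 * n) := cast_ord cardV (enum_rank x).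
pose h (i : 'I_(2 * n)) : option F := enum_val (cast_ord (esym cardV) i).
have gK : cancel g h by move=> x; rewrite /h /g cast_ordK enum_rankK.
have hK : cancel h g by move=> i; rewrite /h /g enum_valK cast_ordKV.
exists (orbit_mset g h sigma); split.
- exact: orbit_factorization.
- exact: orbit_simple.
- exact: orbit_indecomposable.
Qed.
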